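(* Let $\mathcal{H}_1,\mathcal{H}_2,\ldots,\mathcal{H}_n$ be complex Hilbert spaces and let $\alpha\in[0,1]$. Let $T=(T_{ij})$ be an $n\times n$ operator matrix, where $T_{ij}\in\mathcal{B}(\mathcal{H}_j,\mathcal{H}_i)$. Then $$\|T\|_{\alpha}\le\sqrt{\left\|\alpha|R|^2+(1-\alpha)|S|^2\right\|},$$ where $R=(r_{ij})_{n\times n}$ with $r_{ij}=w(T_{ij})$ if $i=j$ and $r_{ij}=\frac12\left(\|T_{ij}\|+\|T_{ji}\|\right)$ if $i\ne j$, and $S=(s_{ij})_{n\times n}$ with $s_{ij}=\|T_{ij}\|$.
   Context: $\mathcal{B}(\mathcal{H}_j,\mathcal{H}_i)$ is the space of bounded linear operators from $\mathcal{H}_j$ to $\mathcal{H}_i$, and $\|\cdot\|$ is the usual operator norm. An $n\times n$ operator matrix $T=(T_{ij})$ acts on the Hilbert space direct sum $\oplus_{i=1}^n\mathcal{H}_i$ by $(Tx)_i=\sum_{j}T_{ij}x_j$. For a bounded operator $T$ on a complex Hilbert space $\mathcal{K}$: the numerical radius is $w(T)=\sup\{|\langle Tx,x\rangle|:x\in\mathcal{K},\ \|x\|=1\}$; $|T|=(T^*T)^{1/2}$; and for $\alpha\in[0,1]$ the $\alpha$-norm is $\|T\|_{\alpha}=\sup\left\{\sqrt{\alpha|\langle Tx,x\rangle|^2+(1-\alpha)\|Tx\|^2}: x\in\mathcal{K},\ \|x\|=1\right\}$. Scalar $n\times n$ matrices (such as $R,S$) are regarded as operators on $\mathbb{C}^n$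 with the standard inner product. *)

(* Defs.v *)
From HB Require Import structures.
From mathcomp Require Import all_boot all_order all_algebra.
From mathcomp Require Import complex.
From mathcomp Require Import boolp classical_sets functions reals topology normedtype.
From mathcomp Require Import ring.

Set Implicit Arguments.
Unset Strict Implicit.
Unset Printing Implicit Defensive.

Import Order.TTheory GRing.Theory Num.Theory.
Import numFieldNormedType.Exports.

Local Open Scope classical_set_scope.
Local Open Scope complex_scope.
Local Open Scope sesquilinear_scope.
Local Open Scope ring_scope.

(* The field R[i]; HB records a bare R[i] used as a structure parameter as an
   unfolded structure, which then shows up in every norm. *)
Local Notation cfield R := (complex_complex__canonical__Num_NumField R).

(* The inner product is linear in its first argument and conjugate-linear in
   its second one. *)
HB.mixin Record NormedModule_hasInner (R : realType) V
    of NormedModule (cfield R) V := {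
  inner : {dot V for Num.conj};
  innerE : forall x : V, inner x x = `|x| ^+ 2
}.

#[short(type="preHilbertType")]
HB.structure Definition PreHilbert (R : realType) :=
  {V of NormedModule (cfield R) V & NormedModule_hasInner R V}.

#[short(type="hilbertType")]
HB.structure Definition Hilbert (R : realType) :=
  {V of PreHilbert R V & Complete V}.

Section CauchySchwarz.
Variables (C : numClosedFieldType) (U : lmodType C) (f : {dot U for Num.conj}).

Lemma dot_CauchySchwarz u v : `|f u v| ^+ 2 <= f u u * f v v.
Proof.
have [->|v0] := eqVneq v 0; first by rewrite !linear0r normr0 expr0n mulr0.
have fv : 0 < f v v by rewrite dnorm_gt0.
pose a := f u v / f v v.
have : 0 <= f (u - a *: v) (u - a *: v) by exact: dnorm_ge0.
have fvu : f v u = (f u v)^*%R by rewrite hermC expr0 mul1r.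
have fvr : (f v v)^*%R = f v v by apply/CrealP/ger0_real/ltW.
have -> : f (u - a *: v) (u - a *: v) = f u u - `|f u v| ^+ 2 / f v v.
  rewrite linearBl/= !linearBr/= !linearZl_LR/= !linearZr_LR/= fvu.
  rewrite /a rmorphM/= fmorphV/= fvr normCK.
  by field; rewrite gt_eqF.
by rewrite subr_ge0 ler_pdivrMr.
Qed.

Lemma dot_triangle u v :
  sqrtC (f (u + v) (u + v)) <= sqrtC (f u u) + sqrtC (f v v).
Proof.
have fu : 0 <= f u u by exact: dnorm_ge0.
have fv : 0 <= f v v by exact: dnorm_ge0.
have fuv : 0 <= f (u + v) (u + v) by exact: dnorm_ge0.
have s0 : 0 <= sqrtC (f u u) + sqrtC (f v v) by rewrite addr_ge0 ?sqrtC_ge0.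
rewrite -[leRHS](sqrCK s0) ler_sqrtC ?qualifE/= ?exprn_ge0//.
rewrite sqrrD !sqrtCK dnormD [leRHS]addrAC lerD2l -sqrtCM ?qualifE//= mulr2n.
have cs : `|f u v| <= sqrtC (f u u * f v v).
  rewrite -(sqrCK (normr_ge0 (f u v))) ler_sqrtC ?qualifE/= ?mulr_ge0 ?exprn_ge0//.
  exact: dot_CauchySchwarz.
apply: le_trans _ (lerD cs cs).
have -> : f u v + (f u v)^*%R = 'Re (f u v) + 'Re (f u v).
  by rewrite ReE; field.
have re (z : C) : 'Re z <= `|z|.
  by rewrite (le_trans (real_ler_norm (Creal_Re _)))// leif_normC_Re_Creal.
by rewrite lerD.
Qed.

End CauchySchwarz.

HB.factory Record Lmodule_isInner (R : realType) V of GRing.Lmodule R[i] V := {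
  dot : {dot V for Num.conj} }.

HB.builders Context (R : realType) V of Lmodule_isInner R V.

Let nrm (x : V) : R[i] := sqrtC (dot x x).

Let nrmZ l x : nrm (l *: x) = `|l| * nrm x.
Proof.
by rewrite /nrm dnormZ sqrtCM ?qualifE/= ?exprn_ge0 ?dnorm_ge0// sqrCK.
Qed.

Let nrm0 x : nrm x = 0 -> x = 0.
Proof. by move=> /eqP; rewrite sqrt_dnorm_eq0 => /eqP. Qed.

HB.instance Definition _ :=
  Lmodule_isNormed.Build (cfield R) V (@dot_triangle _ _ dot) nrmZ nrm0.

Let dotE (x : V) : dot x x = `|x| ^+ 2.
Proof. by rewrite [`|x|]/(nrm x) sqrtCK. Qed.

HB.instance Definition _ := NormedModule_hasInner.Build R V dotE.

HB.end.

Section ComplexLine.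
Variable R : realType.

(* The one-dimensional Hilbert space. An alias, because the library keeps the
   completeness instance on regular modules for the real line. *)
Definition cplx : Type := R[i]^o.

HB.instance Definition _ := NormedModule.copy cplx R[i]^o.

Lemma complex_complete (F : set_system cplx) :
  ProperFilter F -> cauchy F -> cvg F.
Proof.
move=> FF Fc.
have cauchyF (f : R[i] -> R) : (forall x y, f (x - y) = f x - f y) ->
    (forall x, `|f x|%:C <= `|x|) -> cvg (f @ F).
  move=> fB fle; apply: cauchy_cvg; apply/cauchy_ballP => e e0.
  rewrite near_map2; move/cauchy_ballP : Fc => /(_ e%:C).
  rewrite ltcR => /(_ e0); apply: filter_app; near=> x.
  rewrite -!ball_normE /= => xe.
  by rewrite -ltcR -fB (le_lt_trans (fle _)).
have /cvg_ex[a Fa] : cvg (@complex.Re R @ F).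
  by apply: cauchyF; [case=> ? ? []|exact: normc_ge_Re].
have /cvg_ex[b Fb] : cvg (@complex.Im R @ F).
  apply: cauchyF; first by case=> ? ? [].
  move=> [x y]; rewrite normc_def lecR -sqrtr_sqr ler_sqrt /=.
    by rewrite lerDr sqr_ge0.
  by rewrite addr_ge0 ?sqr_ge0.
apply/cvg_ex; exists (a +i* b); apply/cvgrPdist_lt => -[e e'] /=.
rewrite ltcE /= => /andP[/eqP -> e0].
move/cvgrPdist_lt : Fa => /(_ (e / 2)); rewrite divr_gt0// => /(_ isT) Fa.
move/cvgrPdist_lt : Fb => /(_ (e / 2)); rewrite divr_gt0// => /(_ isT) Fb.
near=> z.
have -> : (a +i* b) - z = (a - complex.Re z)%:C + 'i%C * (b - complex.Im z)%:C.
  by case: {+}z => x y; apply/eqP; rewrite eq_complex /=; simpc; rewrite ?eqxx.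
apply: le_lt_trans (ler_normD _ _) _.
rewrite normrM [`|'i%C|]normc_def /= expr0n expr1n add0r sqrtr1 mul1r.
rewrite !normc_def /= !expr0n !addr0 !sqrtr_sqr -[_ +i* 0]/((_)%:C).
rewrite -rmorphD ltcR [ltRHS]splitr ltrD//; [near: z; exact: Fa|near: z; exact: Fb].
Unshelve. all: by end_near. Qed.

HB.instance Definition _ :=
  Uniform_isComplete.Build cplx complex_complete.

Definition cinner (x y : cplx) : R[i] := x * (y : R[i])^*%R.

Let cinnerDl y : linear_for *%R (cinner^~ y).
Proof. by move=> a u v; rewrite /cinner mulrDl mulrA. Qed.

Let cinnerDr x : linear_for (Num.conj \; *%R) (cinner x).
Proof.
move=> a u v; rewrite /cinner rmorphD mulrDr /= rmorphM; congr (_ + _).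
by rewrite mulrCA.
Qed.

HB.instance Definition _ := @bilinear_isBilinear.Build R[i] cplx cplx R[i]
  *%R (Num.conj \; *%R) cinner (cinnerDl, cinnerDr).

Let cinnerC x y : cinner x y = (-1) ^+ false * (cinner y x)^*%R.
Proof. by rewrite expr0 mul1r /cinner rmorphM /= conjCK mulrC. Qed.

HB.instance Definition _ := @isHermitianSesquilinear.Build R[i] cplx
  false Num.conj cinner cinnerC.

Let cinner_gt0 x : x != 0 -> 0 < cinner x x.
Proof. by move=> x0; rewrite /cinner -normCK exprn_gt0// normr_gt0. Qed.

HB.instance Definition _ := @isDotProduct.Build R[i] cplx cinner cinner_gt0.

Let cinnerE (x : cplx) : cinner x x = `|x| ^+ 2.
Proof. by rewrite /cinner -normCK. Qed.

HB.instance Definition _ := NormedModule_hasInner.Build R cplx cinnerE.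

End ComplexLine.

Section DirectSum.
Variables (R : realType) (n : nat) (H : 'I_n -> hilbertType R).

Definition dsum : Type := forall i, H i.

HB.instance Definition _ := gen_eqMixin dsum.
HB.instance Definition _ := gen_choiceMixin dsum.

Let addA : associative (fun x y : dsum => (fun i => x i + y i) : dsum).
Proof. by move=> x y z; apply: functional_extensionality_dep => i; rewrite addrA. Qed.
Let addC : commutative (fun x y : dsum => (fun i => x i + y i) : dsum).
Proof. by move=> x y; apply: functional_extensionality_dep => i; rewrite addrC. Qed.
Let add0 : left_id ((fun i => 0) : dsum)
  (fun x y : dsum => (fun i => x i + y i) : dsum).
Proof. by move=> x; apply: functional_extensionality_dep => i; rewrite add0r. Qed.
Let addN : left_inverse ((fun i => 0) : dsum) (fun x i => - x i)
  (fun x y : dsum => (fun i => x i + y i) : dsum).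
Proof. by move=> x; apply: functional_extensionality_dep => i; rewrite addNr. Qed.

HB.instance Definition _ := GRing.isZmodule.Build dsum addA addC add0 addN.

Let scale (a : R[i]) (x : dsum) : dsum := fun i => a *: x i.
Let scaleA a b x : scale a (scale b x) = scale (a * b) x.
Proof. by apply: functional_extensionality_dep => i; rewrite /scale scalerA. Qed.
Let scale1 : left_id 1 scale.
Proof. by move=> x; apply: functional_extensionality_dep => i; rewrite /scale scale1r. Qed.
Let scaleDr : right_distributive scale +%R.
Proof. by move=> a x y; apply: functional_extensionality_dep => i; rewrite /scale scalerDr. Qed.
Let scaleDl x : {morph scale^~ x : a b / a + b}.
Proof. by move=> a b; apply: functional_extensionality_dep => i; rewrite /scale scalerDl. Qed.

HB.instance Definition _ :=
  GRing.Zmodule_isLmodule.Build R[i] dsum scaleA scale1 scaleDr scaleDl.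

Definition dsum_inner (x y : dsum) : R[i] := \sum_i inner (x i) (y i).

Let dsum_innerDl y : linear_for *%R (dsum_inner^~ y).
Proof.
move=> a u v; rewrite /dsum_inner mulr_sumr -big_split; apply: eq_bigr => i _ /=.
by rewrite linearDl linearZl_LR.
Qed.

Let dsum_innerDr x : linear_for (Num.conj \; *%R) (dsum_inner x).
Proof.
move=> a u v; rewrite /dsum_inner /= mulr_sumr -big_split; apply: eq_bigr => i _ /=.
by rewrite linearDr linearZr_LR.
Qed.

HB.instance Definition _ := @bilinear_isBilinear.Build R[i] dsum dsum R[i]
  *%R (Num.conj \; *%R) dsum_inner (dsum_innerDl, dsum_innerDr).

Let dsum_innerC x y : dsum_inner x y = (-1) ^+ false * (dsum_inner y x)^*%R.
Proof.
rewrite expr0 mul1r /dsum_inner rmorph_sum; apply: eq_bigr => i _ /=.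
by rewrite hermC expr0 mul1r.
Qed.

HB.instance Definition _ := @isHermitianSesquilinear.Build R[i] dsum
  false Num.conj dsum_inner dsum_innerC.

Let dsum_inner_gt0 x : x != 0 -> 0 < dsum_inner x x.
Proof.
move=> x0; rewrite lt_def sumr_ge0 ?andbT; last by move=> i _; exact: dnorm_ge0.
apply: contra x0 => /eqP s0; apply/eqP/functional_extensionality_dep => i.
apply/eqP; rewrite -(dnorm_eq0 inner).
move/psumr_eq0P : s0 => -> // j _; exact: dnorm_ge0.
Qed.

HB.instance Definition _ :=
  @isDotProduct.Build R[i] dsum dsum_inner dsum_inner_gt0.

HB.instance Definition _ := Lmodule_isInner.Build R dsum dsum_inner.

Lemma dsum_normE (x : dsum) : `|x| ^+ 2 = \sum_i `|x i| ^+ 2.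
Proof. by rewrite -innerE; apply: eq_bigr => i _; rewrite innerE. Qed.

Lemma le_dsum_norm (x : dsum) i : `|x i| <= `|x|.
Proof.
rewrite -(@ler_pXn2r _ 2) ?qualifE//= dsum_normE (bigD1 i)//= lerDl.
by rewrite sumr_ge0 // => j _; rewrite exprn_ge0.
Qed.

Lemma dsum_norm_le (x : dsum) : `|x| <= \sum_i `|x i|.
Proof.
have s0 (P : pred 'I_n) : 0 <= \sum_(i | P i) `|x i| by rewrite sumr_ge0.
rewrite -(@ler_pXn2r _ 2) ?qualifE//= dsum_normE expr2 mulr_suml.
by apply: ler_sum => i _; rewrite expr2 ler_wpM2l// (bigD1 i)//= lerDl.
Qed.

Lemma dsum_complete (F : set_system dsum) : ProperFilter F -> cauchy F -> cvg F.
Proof.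
move=> FF Fc.
have Fcvg i : cvg ((fun x : dsum => x i) @ F).
  apply: cauchy_cvg; apply/cauchy_ballP => e e0.
  rewrite near_map2; move/cauchy_ballP : Fc => /(_ e e0).
  apply: filter_app; near=> x; rewrite -!ball_normE /= => xe.
  exact: le_lt_trans (le_dsum_norm (x.1 - x.2) i) xe.
pose l : dsum := fun i => lim ((fun x : dsum => x i) @ F).
apply/cvg_ex; exists l; apply/cvgrPdist_lt => e e0.
have en0 : 0 < e / n.+1%:R by rewrite divr_gt0.
have : \forall x \near F, forall i, `|l i - (x : dsum) i| < e / n.+1%:R.
  by apply: filter_forall => i; move/cvgrPdist_lt : (Fcvg i) => /(_ _ en0).
apply: filterS => x xl; apply: le_lt_trans (dsum_norm_le (l - (x : dsum))) _.
apply: (@le_lt_trans _ _ (\sum_(i < n) e / n.+1%:R)).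
  by apply: ler_sum => i _; exact/ltW/xl.
rewrite sumr_const card_ord -[X in X < _]mulr_natl mulrCA gtr_pMr//.
by rewrite ltr_pdivrMr ?mul1r ?ltr_nat.
Unshelve. all: by end_near. Qed.

HB.instance Definition _ := Uniform_isComplete.Build dsum dsum_complete.

End DirectSum.


Section Operators.
Variable R : realType.

(* Norms take their values in R[i]; this is the same number in R. For a scalar
   z : R[i] it is the modulus of z. *)
Definition rnorm (V : normedModType (cfield R)) (x : V) : R := complex.Re `|x|.

Lemma rnormE (V : normedModType (cfield R)) (x : V) : (rnorm x)%:C = `|x|.
Proof. by rewrite /rnorm RRe_real ?normr_real. Qed.

Definition bounded_op (V W : normedModType (cfield R)) (f : V -> W) :=
  exists M : R, forall x, rnorm (f x) <= M * rnorm x.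

(* The suprema below are finite for bounded operators. Over the unit sphere of
   the zero space they are taken over the empty set and equal 0. *)
Definition opnorm (V W : normedModType (cfield R)) (f : V -> W) : R :=
  sup [set rnorm (f x) | x in [set x | rnorm x <= 1]].

Definition numradius (V : hilbertType R) (f : V -> V) : R :=
  sup [set rnorm (inner (f x) x : R[i]^o) | x in [set x | rnorm x = 1]].

Definition alphanorm (alpha : R) (V : hilbertType R) (f : V -> V) : R :=
  sup [set Num.sqrt (alpha * rnorm (inner (f x) x : R[i]^o) ^+ 2
                     + (1 - alpha) * rnorm (f x) ^+ 2)
      | x in [set x | rnorm x = 1]].

End Operators.

Section OperatorMatrix.
Variables (R : realType) (n : nat) (H : 'I_n -> hilbertType R).
Variable T : forall i j, {linear H j -> H i}.

Definition opmx (x : dsum H) : dsum H := fun i => \sum_j T i j (x j).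

Let opmx_linear : linear opmx.
Proof.
move=> a x y; apply: functional_extensionality_dep => i.
rewrite [RHS](_ : _ = a *: (\sum_j T i j (x j)) + \sum_j T i j (y j))//.
rewrite scaler_sumr -big_split /=.
by apply: eq_bigr => j _; rewrite linearP.
Qed.

HB.instance Definition _ := GRing.isLinear.Build R[i] (dsum H) (dsum H) *:%R
  opmx opmx_linear.

Lemma opmx_bounded : (forall i j, bounded_op (T i j)) -> bounded_op opmx.
Proof.
move=> bT.
have /boolp.choice[M TM] (ij : 'I_n * 'I_n) :
  exists M : R, forall x, rnorm (T ij.1 ij.2 x) <= M * rnorm x by exact: bT.
exists (\sum_i \sum_j `|M (i, j)|) => x.
rewrite -lecR rmorphM !rnormE (le_trans (dsum_norm_le _))//.
rewrite rmorph_sum mulr_suml ler_sum//= => i _.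
rewrite (le_trans (ler_norm_sum _ _ _))//.
rewrite rmorph_sum mulr_suml ler_sum//= => j _.
rewrite -!rnormE -rmorphM lecR (le_trans (TM (i, j) (x j)))//=.
apply: (@le_trans _ _ (`|M (i, j)| * rnorm (x j))).
  by rewrite ler_wpM2r ?ler_norm// -ler0c rnormE.
by rewrite ler_wpM2l// -lecR !rnormE le_dsum_norm.
Qed.

End OperatorMatrix.

Section ScalarMatrix.
Variables (R : realType) (n : nat).
Implicit Type A : 'M[R[i]]_n.

Definition Cn : hilbertType R := dsum (fun _ : 'I_n => cplx R : hilbertType R).

Definition mxop A : Cn -> Cn :=
  opmx (fun i j => *:%R (A i j) : {linear cplx R -> cplx R}).

Lemma mxopE A (x : Cn) i : mxop A x i = \sum_j A i j * x j.
Proof. by []. Qed.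

Lemma mxop_mul A B x : mxop (A *m B) x = mxop A (mxop B x).
Proof.
apply: functional_extensionality_dep => i; rewrite !mxopE.
under eq_bigr do rewrite mxE mulr_suml.
rewrite exchange_big; apply: eq_bigr => j _ /=.
by rewrite mxopE mulr_sumr; apply: eq_bigr => k _; rewrite mulrA.
Qed.

Lemma mxop_adjoint A x y : inner (mxop A x) y = inner x (mxop (A^t*) y).
Proof.
rewrite [LHS](_ : _ = \sum_i (\sum_j A i j * x j) * (y i : R[i])^*%R)//.
rewrite [RHS](_ : _ = \sum_j x j * (\sum_i A^t* j i * (y i : R[i]))^*%R)//.
under eq_bigr do rewrite mulr_suml.
rewrite exchange_big; apply: eq_bigr => j _ /=.
rewrite rmorph_sum mulr_sumr; apply: eq_bigr => i _ /=.
by rewrite rmorphM /= !mxE conjCK mulrCA mulrA.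
Qed.

End ScalarMatrix.

Section AbsoluteValue.
Variables (C : numClosedFieldType) (n : nat).
Implicit Types A B : 'M[C]_n.

(* The square root of a positive semidefinite matrix, from its unitary
   diagonalization; spectralmx has a junk value when B is not normal. *)
Definition sqrtmx B : 'M[C]_n :=
  invmx (spectralmx B) *m diag_mx (map_mx sqrtC (spectral_diag B))
    *m spectralmx B.

(* |A|, the square root of A^* A *)
Definition absmx A : 'M[C]_n := sqrtmx (A^t* *m A).

Lemma absmx_normal A : A^t* *m A \is normalmx.
Proof. by apply/normalmxP; rewrite trmx_mul map_mxM trmxCK. Qed.

Lemma absmx_sqr A : absmx A *m absmx A = A^t* *m A.
Proof.
rewrite [RHS](orthomx_spectralP (absmx_normal A)) /absmx /sqrtmx.
set P := spectralmx _; set d := spectral_diag _.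
rewrite !mulmxA mulmxK ?spectral_unit// -[_ *m diag_mx _ *m diag_mx _]mulmxA.
rewrite mulmx_diag; congr (_ *m diag_mx _ *m _).
by apply/rowP => i; rewrite !mxE -expr2 sqrtCK.
Qed.

Lemma spectral_diag_ge0 A i : 0 <= spectral_diag (A^t* *m A) 0 i.
Proof.
have Pu := spectral_unitarymx (A^t* *m A).
have := orthomx_spectralP (absmx_normal A).
set P := spectralmx _ in Pu *; set d := spectral_diag _ => defA.
have -> : d 0 i = ((A *m P^t*)^t* *m (A *m P^t*)) i i.
  rewrite trmx_mul map_mxM trmxCK mulmxA -[P *m _ *m A]mulmxA defA !mulmxA.
  rewrite mulmxV ?unitarymx_unit// mul1mx -(invmx_unitary Pu).
  by rewrite mulmxK ?unitarymx_unit// mxE eqxx mulr1n.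
by rewrite mxE sumr_ge0// => k _; rewrite !mxE mulrC -normCK exprn_ge0.
Qed.

Lemma absmx_ge0 A (x : 'cV_n) : 0 <= (x^t* *m absmx A *m x) 0 0.
Proof.
rewrite /absmx /sqrtmx invmx_unitary ?spectral_unitarymx//.
set P := spectralmx _; set d := spectral_diag _.
have -> : x^t* *m (P^t* *m diag_mx (map_mx sqrtC d) *m P) *m x
    = (P *m x)^t* *m diag_mx (map_mx sqrtC d) *m (P *m x).
  by rewrite trmx_mul map_mxM !mulmxA.
rewrite mxE sumr_ge0// => k _; rewrite mul_mx_diag !mxE mulrAC.
by rewrite mulr_ge0 ?sqrtC_ge0 ?spectral_diag_ge0// mulrC -normCK exprn_ge0.
Qed.

End AbsoluteValue.

Section NormMatrices.
Variables (R : realType) (n : nat) (H : 'I_n -> hilbertType R).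
Variable T : forall i j, {linear H j -> H i}.

Definition Rmx : 'M[R[i]]_n := \matrix_(i, j)
  (if i == j then numradius (T i i)
   else (opnorm (T i j) + opnorm (T j i)) / 2)%:C.

Definition Smx : 'M[R[i]]_n := \matrix_(i, j) (opnorm (T i j))%:C.

End NormMatrices.

(* Main.v *)
Require Import Defs.
From HB Require Import structures.
From mathcomp Require Import all_boot all_order all_algebra.
From mathcomp Require Import complex.
From mathcomp Require Import boolp classical_sets functions reals topology normedtype.

Set Implicit Arguments.
Unset Strict Implicit.
Unset Printing Implicit Defensive.

Import Order.TTheory GRing.Theory Num.Theory.
Import numFieldNormedType.Exports.

Local Open Scope complex_scope.
Local Open Scope ring_scope.

(** The theorem reduces to one vector of scalars. To a vector [x] of the direct
sum attach the vector [a] of C^n with entries [a_i = |x_i|]; it has the same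
norm as [x], and it turns the two quantities in the alpha-norm into quadratic
forms of scalar matrices.

- Expanding [<T x, x>] into the [<T_ij x_j, x_i>], the diagonal terms are at
  most [w(T_ii) a_i^2] and the others at most [|T_ij| a_i a_j]. A quadratic form
  only sees the symmetric part of its matrix, so the sum of these bounds is
  [<R a, a>], which is at most [|R a|] when [x] is a unit vector
  ([opmx_inner_le], [opmx_inner_le_Rmx]).
- The triangle inequality in each coordinate gives [|T x| <= |S a|]
  ([opmx_norm_le_Smx]).

Since [|A a|^2 = <|A|^2 a, a>] for each scalar matrix [A] ([absmx_form]), the
number under the square root in the alpha-norm is at most [<M a, a>], where
[M = alpha |R|^2 + (1 - alpha) |S|^2], and Cauchy-Schwarz bounds this by the
operator norm of [M]. *)

(** * Real-valued norms *)

Section RealNorm.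
Variable R : realType.
Local Notation cfield R := (complex_complex__canonical__Num_NumField R).
Implicit Types V W : normedModType (cfield R).

Lemma rnorm_ge0 V (x : V) : 0 <= rnorm x.
Proof. by rewrite -ler0c rnormE. Qed.

Lemma rnorm0 V : rnorm (0 : V) = 0.
Proof. by rewrite /rnorm normr0. Qed.

Lemma rnorm_eq0 V (x : V) : (rnorm x == 0) = (x == 0).
Proof. by rewrite -[RHS]normr_eq0 -rnormE; apply/eqP/eqP => [->|[]]. Qed.

Lemma rnormZ V (c : R) (x : V) : rnorm (c%:C *: x) = `|c| * rnorm x.
Proof.
apply: complexI; rewrite rmorphM /= !rnormE normrZ; congr (_ * _).
by rewrite normc_def /= expr0n addr0 sqrtr_sqr.
Qed.

Lemma rnorm_sum_le V (I : finType) (F : I -> V) :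
  rnorm (\sum_i F i) <= \sum_i rnorm (F i).
Proof.
rewrite -lecR rnormE rmorph_sum /=; under [leRHS]eq_bigr do rewrite rnormE.
exact: ler_norm_sum.
Qed.

Lemma real_le_rnorm (c : R) : c <= rnorm (c%:C : R[i]^o).
Proof.
by rewrite /rnorm normc_def /= expr0n addr0 sqrtr_sqr ler_norm.
Qed.

Lemma rnorm_inner_le (V : hilbertType R) (x y : V) :
  rnorm (inner x y : R[i]^o) <= rnorm x * rnorm y.
Proof.
rewrite -(@ler_pXn2r _ 2) ?nnegrE ?mulr_ge0 ?rnorm_ge0// -lecR.
rewrite !rmorphXn rmorphM /= !rnormE exprMn -!innerE.
exact: dot_CauchySchwarz.
Qed.

End RealNorm.

(** * The operator norm and the numerical radius as bounds *)

Section Bounds.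
Variable R : realType.
Local Notation cfield R := (complex_complex__canonical__Num_NumField R).

Lemma opnorm_ge (V W : normedModType (cfield R)) (f : {linear V -> W}) (x : V) :
  bounded_op f -> rnorm (f x) <= opnorm f * rnorm x.
Proof.
move=> [M fM]; have [->|x0] := eqVneq x 0.
  by rewrite linear0 !rnorm0 mulr0.
have nx : 0 < rnorm x by rewrite lt_def rnorm_eq0 x0 rnorm_ge0.
have cx : 0 <= (rnorm x)^-1 by rewrite invr_ge0 ltW.
rewrite -ler_pdivrMr// mulrC -[X in X * _]ger0_norm// -rnormZ -linearZ.
apply: ub_le_sup; last first.
  exists ((rnorm x)^-1%:C *: x) => //=.
  by rewrite rnormZ ger0_norm// mulVf// gt_eqF.
exists `|M| => _ [y /= y1 <-]; apply: le_trans (fM y) _.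
rewrite (le_trans (ler_norm _))// normrM ler_piMr//.
by rewrite ger0_norm ?rnorm_ge0.
Qed.

(** Both sides are homogeneous of degree 2 in [x], so it is enough to consider
the unit vector [y] on the line of [x]. Boundedness of [f] makes the supremum
that defines the numerical radius finite. *)
Lemma numradius_ge (V : hilbertType R) (f : {linear V -> V}) (x : V) :
  bounded_op f -> rnorm (inner (f x) x : R[i]^o) <= numradius f * rnorm x ^+ 2.
Proof.
move=> bf; have [->|x0] := eqVneq x 0.
  by rewrite linear0r !rnorm0 expr0n mulr0.
have nx : 0 < rnorm x by rewrite lt_def rnorm_eq0 x0 rnorm_ge0.
have cx : 0 <= (rnorm x)^-1 by rewrite invr_ge0 ltW.
pose y := (rnorm x)^-1%:C *: x.
have y1 : rnorm y = 1 by rewrite rnormZ ger0_norm// mulVf// gt_eqF.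
have xE : x = (rnorm x)%:C *: y.
  by rewrite scalerA -rmorphM mulfV ?gt_eqF// scale1r.
have -> : inner (f x) x = (rnorm x ^+ 2)%:C *: (inner (f y) y : R[i]^o).
  rewrite [in LHS]xE [f _]linearZ linearZl_LR [X in _ * X]linearZr_LR /=.
  by rewrite [_^*%R]conjc_real mulrA -rmorphM.
rewrite rnormZ ger0_norm ?sqr_ge0// mulrC ler_wpM2r ?sqr_ge0//.
apply: ub_le_sup; last by exists y.
exists (opnorm f) => _ [z /= z1 <-].
apply: le_trans (rnorm_inner_le _ _) _.
by rewrite z1 mulr1 (le_trans (opnorm_ge _ bf))// z1 mulr1.
Qed.

End Bounds.

(** * Scalar matrices *)

Section Scalar.
Variables (R : realType) (n : nat).
Implicit Types (A : 'M[R[i]]_n) (v : Cn R n).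

Lemma mxop_bounded A : bounded_op (mxop A).
Proof.
apply: opmx_bounded => i j; exists (rnorm (A i j : R[i]^o)) => x.
by rewrite -lecR rmorphM /= !rnormE normrZ.
Qed.

(** By [absmx_sqr], [|A|^2] is [A^* A], whose factor [A^*] passes to the other
side of the inner product. *)
Lemma absmx_form A v :
  inner (mxop (absmx A ^+ 2) v) v = ((rnorm (mxop A v)) ^+ 2)%:C.
Proof.
rewrite expr2 [_ * _]absmx_sqr mxop_mul mxop_adjoint trmxCK innerE.
by rewrite rmorphXn /= rnormE.
Qed.

Lemma mxop_lin (a b : R[i]) A B v :
  mxop (a *: A + b *: B) v = a *: mxop A v + b *: mxop B v.
Proof.
apply: functional_extensionality_dep => i.
rewrite [RHS](_ : _ = a *: mxop A v i + b *: mxop B v i)//.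
rewrite !mxopE !scaler_sumr -big_split; apply: eq_bigr => j _ /=.
by rewrite !mxE mulrDl -!mulrA.
Qed.

End Scalar.

(** * Comparison of an operator matrix with scalar matrices *)

Lemma rnorm_dsum (R : realType) n (H : 'I_n -> hilbertType R) (x : dsum H) :
  rnorm x ^+ 2 = \sum_i rnorm (x i) ^+ 2.
Proof.
apply: complexI; rewrite rmorphXn rmorph_sum /= rnormE dsum_normE.
by apply: eq_bigr => i _; rewrite rmorphXn /= rnormE.
Qed.

Section Comparison.
Variables (R : realType) (n : nat) (H : 'I_n -> hilbertType R).
Variable T : forall i j, {linear H j -> H i}.
Hypothesis bT : forall i j, bounded_op (T i j).
Implicit Type x : dsum H.

Definition normvec x : Cn R n := fun i => (rnorm (x i))%:C.

Lemma rnorm_normvec x : rnorm (normvec x) = rnorm x.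
Proof.
apply/eqP; rewrite -(@eqrXn2 _ 2) ?rnorm_ge0// !rnorm_dsum; apply/eqP.
apply: eq_bigr => i _; congr (_ ^+ 2); rewrite [LHS]/rnorm normc_def /=.
by rewrite expr0n addr0 sqrtr_sqr ger0_norm ?rnorm_ge0.
Qed.

(** The factor in the bound of [<T_ij x_j, x_i>] by a multiple of [|x_i| |x_j|].
It is in general not symmetric in [i] and [j]; the matrix [R] is its symmetric
part ([RmxE]). *)
Definition entry_bound i j : R :=
  if i == j then numradius (T i i) else opnorm (T i j).

Lemma RmxE i j : Rmx T i j = ((entry_bound i j + entry_bound j i) / 2)%:C.
Proof.
rewrite mxE /entry_bound; case: eqVneq => [->|//].
by rewrite mulrDl -splitr.
Qed.

Lemma opmx_inner_le x : rnorm (inner (opmx T x) x : R[i]^o) <=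
  \sum_i \sum_j entry_bound i j * (rnorm (x i) * rnorm (x j)).
Proof.
have -> : inner (opmx T x) x = \sum_i \sum_j inner (T i j (x j)) (x i).
  by apply: eq_bigr => i _; rewrite /opmx linear_sumlz.
apply: le_trans (@rnorm_sum_le _ R[i]^o _ _) _; apply: ler_sum => i _.
apply: le_trans (@rnorm_sum_le _ R[i]^o _ _) _; apply: ler_sum => j _.
rewrite /entry_bound; case: eqVneq => [<-|ij].
  by rewrite -expr2; exact: numradius_ge.
apply: le_trans (rnorm_inner_le _ _) _.
by rewrite [X in _ <= _ * X]mulrC mulrA ler_wpM2r ?rnorm_ge0// opnorm_ge.
Qed.

(** Averaging the double sum of [opmx_inner_le] with its transpose replaces the
entry bounds by the entries of [R], without changing the sum. *)
Lemma Rmx_form x : inner (mxop (Rmx T) (normvec x)) (normvec x) =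
  (\sum_i \sum_j entry_bound i j * (rnorm (x i) * rnorm (x j)))%:C.
Proof.
set s := \sum_i _.
have -> : s = \sum_i \sum_j (entry_bound i j + entry_bound j i) / 2
                            * (rnorm (x i) * rnorm (x j)).
  have -> : s = (s + s) / 2 by rewrite mulrDl -splitr.
  rewrite {2}/s exchange_big /= -big_split mulr_suml; apply: eq_bigr => i _ /=.
  rewrite -big_split mulr_suml; apply: eq_bigr => j _ /=.
  by rewrite [rnorm (x j) * _]mulrC -mulrDl mulrAC.
rewrite rmorph_sum; apply: eq_bigr => i _ /=.
rewrite [LHS](_ : _ = mxop (Rmx T) (normvec x) i * (normvec x i)^*%R)//.
rewrite mxopE mulr_suml rmorph_sum; apply: eq_bigr => j _ /=.
by rewrite RmxE /normvec [_^*%R]conjc_real -!rmorphM -mulrA [rnorm (x j) * _]mulrC.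
Qed.

(** The sum in [opmx_inner_le] is now [<R a, a>] with [a] of norm 1, and
Cauchy-Schwarz applies. *)
Lemma opmx_inner_le_Rmx x : rnorm x = 1 ->
  rnorm (inner (opmx T x) x : R[i]^o) <= rnorm (mxop (Rmx T) (normvec x)).
Proof.
move=> x1; apply: le_trans (opmx_inner_le x) _.
apply: le_trans (real_le_rnorm _) _; rewrite -Rmx_form.
by apply: le_trans (rnorm_inner_le _ _) _; rewrite rnorm_normvec x1 mulr1.
Qed.

(** The squares of both norms are sums over the coordinates, and the inequality
holds in each of them: [|sum_j T_ij x_j| <= sum_j |T_ij| |x_j|]. *)
Lemma opmx_norm_le_Smx x :
  rnorm (opmx T x) <= rnorm (mxop (Smx T) (normvec x)).
Proof.
have -> : mxop (Smx T) (normvec x) =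
    (fun i => (\sum_j opnorm (T i j) * rnorm (x j))%:C) :> Cn R n.
  apply: functional_extensionality_dep => i; rewrite mxopE rmorph_sum.
  by apply: eq_bigr => j _; rewrite mxE /normvec -rmorphM.
rewrite -(@ler_pXn2r _ 2) ?nnegrE ?rnorm_ge0// rnorm_dsum.
rewrite rnorm_dsum; apply: ler_sum => i _.
rewrite ler_pXn2r ?nnegrE ?rnorm_ge0//.
apply: le_trans (rnorm_sum_le _) _; apply: le_trans (real_le_rnorm _).
by apply: ler_sum => j _; exact: opnorm_ge.
Qed.

End Comparison.

Theorem theorem2p8 (R : realType) (n : nat) (H : 'I_n -> hilbertType R)
    (alpha : R) (T : forall i j : 'I_n, {linear H j -> H i}) :
  0 <= alpha <= 1 ->
  (forall i j : 'I_n, bounded_op (T i j)) ->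
  alphanorm alpha (opmx T) <=
    Num.sqrt (opnorm (mxop (alpha%:C *: absmx (Rmx T) ^+ 2
                            + (1 - alpha)%:C *: absmx (Smx T) ^+ 2))).
Proof.
move=> /andP[a0 a1] bT; set M := alpha%:C *: _ + _.
(* When the direct sum is the zero space, the supremum is over the empty set. *)
rewrite /alphanorm; set A := (A in sup A); have [->|/set0P A0] := eqVneq A set0.
  by rewrite sup0 sqrtr_ge0.
apply: ge_sup => // _ [x /= x1 <-]; rewrite ler_wsqrtr//.
set v := normvec x; have v1 : rnorm v = 1 by rewrite rnorm_normvec.
apply: (@le_trans _ _ (alpha * rnorm (mxop (Rmx T) v) ^+ 2
                       + (1 - alpha) * rnorm (mxop (Smx T) v) ^+ 2)).
  rewrite lerD// ler_wpM2l ?subr_ge0// ler_pXn2r ?nnegrE ?rnorm_ge0//.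
    exact: opmx_inner_le_Rmx.
  exact: opmx_norm_le_Smx.
apply: le_trans (real_le_rnorm _) _.
rewrite rmorphD [X in X + _]rmorphM [X in _ + X]rmorphM /=.
rewrite -!absmx_form -!linearZl_LR -linearDl -mxop_lin.
apply: le_trans (rnorm_inner_le _ _) _; rewrite v1 mulr1.
apply: le_trans (opnorm_ge _ (mxop_bounded _)) _.
by rewrite v1 mulr1.
Qed.
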